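(* Let $G$ be a group and let $\mathcal{G}^G$ be the category of groups over $G$. Denote by $\Omega^G$ the class of morphisms $f:\gamma_A\to\gamma_B$ in $\mathcal{G}^G$ satisfying the following properties: (1) $A$ is finitely generated and $B$ is finitely presented; (2) $\Gamma\gamma_A$ and $\Gamma\gamma_B$ are finitely normally generated in $A$ and $B$, respectively; (3) $f$ induces a normal surjection $\Gamma\gamma_A\to\Gamma\gamma_B$; (4) $f_i: H_i(A;\mathbb{Z}[G])\to H_i(B;\mathbb{Z}[G])$ is an isomorphism for $i=1$ and an epimorphism for $i=2$. Then there is a localization $(E,p)$ on $\mathcal{G}^G$ under which elements of $\Omega^G$ become isomorphisms, i.e. $E(f)$ is an isomorphism for every $f\in\Omega^G$.
   Context: For a fixed group $G$, the category $\mathcal{G}^G$ of groups over $G$ has as objects the surjective group homomorphisms $\gamma_A:A\to G$, and as morphisms $f:\gamma_A\to\gamma_B$ the group homomorphisms $f:A\to B$ with $\gamma_B\circ f=\gamma_A$. For an object $\gamma_A$, put $\Gamma\gamma_A=\mathrm{Ker}(\gamma_A)$. A normal subgroup is finitely normally generated in $A$ if it is the normal closure in $A$ of a finite set. ''$f$ induces a normal surjection $\Gamma\gamma_A\to\Gamma\gamma_B$'' means that $\Gamma\gamma_B$ is the normal closure in $B$ of $f(\Gamma\gamma_A)$. $H_i(A;\mathbb{Z}[G])$ is group homology with coefficients in $\mathbb{Z}[G]$, regarded as an $A$-module via $\gamma_A$. An object $\gamma_X$ is local ($\Omega^G$-local) if for every morphism $\gamma_A\to\gamma_B$ in $\Omega^G$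 and every morphism $\gamma_A\to\gamma_X$ there is a unique morphism $\gamma_B\to\gamma_X$ such that the composite $\gamma_A\to\gamma_B\to\gamma_X$ is the given morphism $\gamma_A\to\gamma_X$. A localization is a pair $(E,p)$, where $E:\mathcal{G}^G\to\mathcal{G}^G$ is a functor and $p: \mathrm{id}_{\mathcal{G}^G}\to E$ is a natural transformation such that for every morphism $\gamma_A\to\gamma_X$ into a local object $\gamma_X$ there is a unique morphism $E(\gamma_A)\to\gamma_X$ whose composite with $p(\gamma_A):\gamma_A\to E(\gamma_A)$ is the given morphism. *)

(* Defs.v *)
From HB Require Import structures.
From mathcomp Require Import all_boot all_order all_algebra.
From mathcomp Require Import boolp classical_sets cardinality.
From mathcomp Require Import finmap.
From mathcomp.multinomials Require Import monalg.

Set Implicit Arguments.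
Unset Strict Implicit.
Unset Printing Implicit Defensive.

Local Open Scope classical_set_scope.
Local Open Scope group_scope.

(* A [groupType] need not be finite.  It carries decidable equality and a
   choice operator, which in the present classical setting every type has. *)

Lemma multiplicative_ext (A B : groupType) (f g : {multiplicative A -> B}) :
  f =1 g -> f = g.
Proof.
case: f g => f [[fM]] [g [[gM]]] /= /funext fg; subst g.
by rewrite (Prop_irrelevance fM gM).
Qed.

Definition subgroup (A : groupType) : set (set A) :=
  [set S | [/\ S 1, forall x y, S x -> S y -> S (x * y) &
               forall x, S x -> S x^-1]].

Definition normal_subgroup (A : groupType) : set (set A) :=
  [set S | subgroup S /\ forall x y, S x -> S (x ^ y)].

Definition generated (A : groupType) (S : set A) : set A :=
  smallest (@subgroup A) S.

Definition normal_closure (A : groupType) (S : set A) : set A :=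
  smallest (@normal_subgroup A) S.

Definition ker (A B : groupType) (f : {multiplicative A -> B}) : set A :=
  [set a | f a = 1].

Definition finitely_generated (A : groupType) : Prop :=
  exists2 S : set A, finite_set S & generated S = [set: A].

Definition finitely_normally_generated (A : groupType) (N : set A) : Prop :=
  exists2 S : set A, finite_set S & normal_closure S = N.

Definition free_on (F : groupType) (n : nat) (x : 'I_n -> F) : Prop :=
  forall (H : groupType) (h : 'I_n -> H),
    exists! phi : {multiplicative F -> H}, forall i, phi (x i) = h i.

Definition finitely_presented (B : groupType) : Prop :=
  exists (n : nat) (F : groupType) (x : 'I_n -> F)
         (pi : {multiplicative F -> B}),
    [/\ free_on x, (forall b, exists w, pi w = b) &
        finitely_normally_generated (ker pi)].

Section GroupsOver.
Variable G : groupType.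

Record grp_over := GrpOver {
  grp_of :> groupType;
  proj_of : {multiplicative grp_of -> G};
  proj_of_surj : forall g, exists a, proj_of a = g }.

Record hom_over (X Y : grp_over) := HomOver {
  hom_fun :> {multiplicative X -> Y};
  hom_funP : forall a, proj_of Y (hom_fun a) = proj_of X a }.

Lemma hom_over_ext X Y (f g : hom_over X Y) : f =1 g -> f = g.
Proof.
case: f g => f fP [g gP] /= /multiplicative_ext fg; subst g.
by rewrite (Prop_irrelevance fP gP).
Qed.

Definition id_over (X : grp_over) : hom_over X X :=
  @HomOver X X (idfun : {multiplicative X -> X}) (fun=> erefl).

Lemma comp_overP X Y Z (g : hom_over Y Z) (f : hom_over X Y) a :
  proj_of Z ((g \o f) a) = proj_of X a.
Proof. by rewrite /= !hom_funP. Qed.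

Definition comp_over X Y Z (g : hom_over Y Z) (f : hom_over X Y) :
    hom_over X Z :=
  @HomOver X Z (hom_fun g \o hom_fun f : {multiplicative X -> Z})
    (comp_overP g f).

Definition iso_over X Y (f : hom_over X Y) : Prop :=
  exists g : hom_over Y X,
    comp_over g f = id_over X /\ comp_over f g = id_over Y.

Record functor_over := FunctorOver {
  fobj :> grp_over -> grp_over;
  fmap : forall X Y, hom_over X Y -> hom_over (fobj X) (fobj Y);
  fmap_id : forall X, fmap (id_over X) = id_over (fobj X);
  fmap_comp : forall X Y Z (g : hom_over Y Z) (f : hom_over X Y),
    fmap (comp_over g f) = comp_over (fmap g) (fmap f) }.

Record nat_from_id (E : functor_over) := NatFromId {
  ncomp :> forall X, hom_over X (E X);
  ncompP : forall X Y (f : hom_over X Y),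
    comp_over (ncomp Y) f = comp_over (fmap E f) (ncomp X) }.

Definition Gam (X : grp_over) : set X := ker (proj_of X).

End GroupsOver.

Section FinSupp.
Local Open Scope ring_scope.
Import GRing.Theory.
Variables (K : choiceType) (V W : zmodType).

(* Additive extension to finitely supported functions. *)
Definition fslift (phi : K -> V -> W) (c : {malg V[K]}) : W :=
  \sum_(k <- msupp c) phi k (mcoeff k c).

Variable phi : K -> {additive V -> W}.

Lemma fsliftEw (c : {malg V[K]}) (d : {fset K}) :
  {subset msupp c <= d} -> fslift phi c = \sum_(k <- d) phi k (mcoeff k c).
Proof.
move=> sub; rewrite /fslift; apply: big_fset_incl; first exact/fsubsetP.
by move=> k _ /mcoeff_outdom ->; rewrite raddf0.
Qed.

Lemma fslift_is_zmod_morphism : zmod_morphism (fslift phi).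
Proof.
move=> c c'; set d := (msupp c `|` msupp c')%fset.
have h1 : {subset msupp c <= d} by move=> k kc; rewrite in_fsetU kc.
have h2 : {subset msupp c' <= d} by move=> k kc; rewrite in_fsetU kc orbT.
have h3 : {subset msupp (c - c') <= d} by apply/fsubsetP/msuppB_le.
rewrite (fsliftEw h1) (fsliftEw h2) (fsliftEw h3) -sumrB.
by apply: eq_bigr => k _; rewrite mcoeffB raddfB.
Qed.

HB.instance Definition _ := GRing.isZmodMorphism.Build {malg V[K]} W
  (fslift phi) fslift_is_zmod_morphism.

Lemma fsliftU k v : fslift phi << v *g k >> = phi k v.
Proof.
rewrite (@fsliftEw _ [fset k]%fset); first by rewrite big_seq_fset1 mcoeffUU.
exact/fsubsetP/msuppU_le.
Qed.

End FinSupp.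

Section GroupRing.
Local Open Scope ring_scope.
Import GRing.Theory.
Variable G : groupType.

Definition ZG : zmodType := {malg int[G]}.

Definition zg_rmul1 (g h : G) : int -> ZG := mkmalgU (h * g)%g.
HB.instance Definition _ g h := GRing.Additive.on (zg_rmul1 g h).

(* Right multiplication by a group element. *)
Definition zg_rmul (g : G) : ZG -> ZG := fslift (zg_rmul1 g).
HB.instance Definition _ g := GRing.Additive.on (zg_rmul g).

End GroupRing.

Section BarFace.
Variables (A : groupType) (n : nat).

(* [a_0|...|a_n] is sent to [a_1|...|a_n] for i = 0, to
   [...|a_(i-1) a_i|...] for 0 < i <= n, and to [a_0|...|a_(n-1)] for
   i = n.+1. *)
Definition bar_face (i : nat) (t : n.+1.-tuple A) : n.-tuple A :=
  [tuple (if j.+1 < i then t`_j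
          else if j.+1 == i then t`_j * t`_j.+1
          else t`_j.+1) | j < n].

End BarFace.

Section BarComplex.
Local Open Scope ring_scope.
Import GRing.Theory.
Variables (G A : groupType) (gam : {multiplicative A -> G}).

(* Z[G] is a right A-module through gam, and [bar n] is the group
   Z[G] (x)_A B_n of n-chains, B being the (unnormalized) bar resolution of Z
   by free left A-modules: << m *g t >> stands for m (x) [t_0|...|t_(n-1)]. *)
Definition bar (n : nat) : zmodType := {malg (ZG G)[n.-tuple A]}.

Definition bar_coef n (i : nat) (t : n.+1.-tuple A) (m : ZG G) : ZG G :=
  if i == 0%N then zg_rmul (gam (t`_0)%g) m else m.

Definition bar_diff1 n (t : n.+1.-tuple A) (m : ZG G) : bar n :=
  \sum_(i < n.+2) << bar_coef i t m *~ (-1) ^+ i *g bar_face i t >>.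

Lemma bar_diff1_is_zmod_morphism n (t : n.+1.-tuple A) :
  zmod_morphism (bar_diff1 t).
Proof.
move=> x y; rewrite /bar_diff1 -sumrB; apply: eq_bigr => i _.
have -> : bar_coef i t (x - y) = bar_coef i t x - bar_coef i t y.
  by rewrite /bar_coef; case: ifP => // _; apply: raddfB.
by rewrite mulrzBl monalgUB.
Qed.

HB.instance Definition _ n t := GRing.isZmodMorphism.Build (ZG G) (bar n)
  (bar_diff1 t) (@bar_diff1_is_zmod_morphism n t).

Definition bar_diff n : bar n.+1 -> bar n := fslift (@bar_diff1 n).
HB.instance Definition _ n := GRing.isZmodMorphism.Build (bar n.+1) (bar n)
  (@bar_diff n) (fslift_is_zmod_morphism (@bar_diff1 n)).

Lemma bar_diffU n (t : n.+1.-tuple A) m :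
  @bar_diff n << m *g t >> = bar_diff1 t m.
Proof. exact: (fsliftU (@bar_diff1 n)). Qed.

(* The differential leaving degree n, with the zero map for n = 0. *)
Definition bar_out n : bar n -> bar n.-1 :=
  match n with 0%N => fun=> 0 | n'.+1 => @bar_diff n' end.

Lemma bar_out_is_zmod_morphism n : zmod_morphism (@bar_out n).
Proof. by case: n => [|n] x y; rewrite /= ?subr0 // raddfB. Qed.

HB.instance Definition _ n := GRing.isZmodMorphism.Build (bar n) (bar n.-1)
  (@bar_out n) (@bar_out_is_zmod_morphism n).

Definition cycle_pred n : {pred bar n} := fun c => bar_out c == 0.

Lemma cycle_pred_closed n : zmod_closed (@cycle_pred n).
Proof.
split=> [|x y]; rewrite /in_mem /= /cycle_pred ?raddf0 //.
by move=> /eqP x0 /eqP y0; rewrite raddfB /= x0 y0 subr0.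
Qed.

HB.instance Definition _ n := GRing.isZmodClosed.Build (bar n)
  (@cycle_pred n) (@cycle_pred_closed n).

Record bar_cycle n := BarCycle {
  cycle_val :> bar n; cycle_valP : cycle_val \in @cycle_pred n }.

HB.instance Definition _ n := [isSub for @cycle_val n].
HB.instance Definition _ n := [Choice of bar_cycle n by <:].
HB.instance Definition _ n := [SubChoice_isSubZmodule of bar_cycle n by <:].

Definition boundary_pred n : {pred bar_cycle n} :=
  fun z => `[< exists c : bar n.+1, bar_diff c = \val z >].

Lemma boundary_pred_closed n : zmod_closed (@boundary_pred n).
Proof.
split=> [|x y]; rewrite /in_mem /=.
  by apply/asboolP; exists 0; rewrite raddf0.
move=> /asboolP[c xE] /asboolP[d yE]; apply/asboolP; exists (c - d).
by rewrite raddfB /= xE yE.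
Qed.

HB.instance Definition _ n := GRing.isZmodClosed.Build (bar_cycle n)
  (@boundary_pred n) (@boundary_pred_closed n).

Definition homology (n : nat) : zmodType :=
  Quotient.quot (@boundary_pred n).

End BarComplex.

Section Functoriality.
Local Open Scope ring_scope.
Local Open Scope quotient_scope.
Import GRing.Theory.
Variables (G : groupType) (X Y : grp_over G) (f : hom_over X Y).

Definition bar_map1 n (t : n.-tuple X) : ZG G -> bar G Y n :=
  mkmalgU (map_tuple f t).
HB.instance Definition _ n t := GRing.Additive.on (@bar_map1 n t).

Definition bar_map n : bar G X n -> bar G Y n := fslift (@bar_map1 n).
HB.instance Definition _ n := GRing.isZmodMorphism.Build
  (bar G X n) (bar G Y n) (@bar_map n) (fslift_is_zmod_morphism (@bar_map1 n)).

Lemma bar_mapU n (t : n.-tuple X) m :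
  @bar_map n << m *g t >> = << m *g map_tuple f t >>.
Proof. exact: (fsliftU (@bar_map1 n)). Qed.

Lemma bar_face_map n i (t : n.+1.-tuple X) :
  bar_face i (map_tuple f t) = map_tuple f (bar_face i t).
Proof.
apply: eq_from_tnth => j; rewrite tnth_mktuple [RHS]tnth_map tnth_mktuple /=.
have jn := ltn_ord j.
rewrite !(nth_map 1%g) ?size_tuple ?ltnS ?(ltnW jn) //.
by do 2?case: ifP => // _; rewrite gmulfM.
Qed.

Lemma bar_coef_map n i (t : n.+1.-tuple X) m :
  bar_coef (proj_of Y) i (map_tuple f t) m = bar_coef (proj_of X) i t m.
Proof.
rewrite /bar_coef; case: ifP => // _.
by rewrite (nth_map 1%g) ?size_tuple // hom_funP.
Qed.

Lemma bar_map_diff n (c : bar G X n.+1) :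
  bar_map (bar_diff (proj_of X) c) = bar_diff (proj_of Y) (bar_map c).
Proof.
have [u [d ->]] : exists (u : n.+1.-tuple X -> ZG G) d,
    c = \sum_(t <- d) << u t *g t >>.
  by exists (mcoeff^~ c), (msupp c); apply: monalgE.
rewrite [bar_diff _ (\sum_(_ <- _) _)]raddf_sum [LHS]raddf_sum.
rewrite [bar_map (\sum_(_ <- _) _)]raddf_sum [RHS]raddf_sum.
apply: eq_bigr => t _ /=.
rewrite bar_diffU bar_mapU bar_diffU /bar_diff1 [LHS]raddf_sum.
apply: eq_bigr => i _ /=; rewrite bar_mapU bar_face_map.
by rewrite bar_coef_map.
Qed.

Lemma bar_map_cycle n (z : bar_cycle (proj_of X) n) :
  bar_map (\val z) \in @cycle_pred G Y (proj_of Y) n.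
Proof.
case: n z => [|n] [c]; rewrite /in_mem /= /cycle_pred //=.
by move=> /eqP c0; rewrite -bar_map_diff c0 raddf0.
Qed.

Definition cycle_map n (z : bar_cycle (proj_of X) n) :
  bar_cycle (proj_of Y) n := BarCycle (bar_map_cycle z).

(* Computed on a chosen representative; [homology_map_pi] shows that the
   choice does not matter. *)
Definition homology_map n (q : homology (proj_of X) n) :
    homology (proj_of Y) n :=
  \pi_(homology (proj_of Y) n) (cycle_map (repr q)).

Lemma homology_map_pi n (z : bar_cycle (proj_of X) n) :
  homology_map (\pi_(homology (proj_of X) n) z) =
  \pi_(homology (proj_of Y) n) (cycle_map z).
Proof.
rewrite /homology_map; case: piP => w /eqP; rewrite -Quotient.idealrBE.
move=> /asboolP[c cE]; apply/eqP; rewrite eq_sym -Quotient.idealrBE.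
apply/asboolP; exists (bar_map c).
by rewrite -bar_map_diff cE !raddfB.
Qed.

Lemma cycle_map_is_zmod_morphism n : zmod_morphism (@cycle_map n).
Proof. by move=> z w; apply/val_inj; rewrite /= raddfB. Qed.

Lemma homology_map_is_zmod_morphism n : zmod_morphism (@homology_map n).
Proof.
move=> x y; rewrite -[x]reprK -[y]reprK -raddfB !homology_map_pi.
by rewrite cycle_map_is_zmod_morphism raddfB.
Qed.

HB.instance Definition _ n := GRing.isZmodMorphism.Build
  (homology (proj_of X) n) (homology (proj_of Y) n) (@homology_map n)
  (@homology_map_is_zmod_morphism n).

End Functoriality.

Section Localization.
Variable G : groupType.

Definition Omega (X Y : grp_over G) (f : hom_over X Y) : Prop :=
  [/\ finitely_generated X /\ finitely_presented Y,
      finitely_normally_generated (@Gam G X) /\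
        finitely_normally_generated (@Gam G Y),
      normal_closure (f @` @Gam G X) = @Gam G Y &
      bijective (@homology_map G X Y f 1) /\
        (forall y, exists x, @homology_map G X Y f 2 x = y)].

Definition local_over (X : grp_over G) : Prop :=
  forall (A B : grp_over G) (f : hom_over A B), Omega f ->
    forall g : hom_over A X, exists! h : hom_over B X, comp_over h f = g.

Definition is_localization (E : functor_over G) (p : nat_from_id E) : Prop :=
  forall (A X : grp_over G) (g : hom_over A X), local_over X ->
    exists! h : hom_over (E A) X, comp_over h (p A) = g.

End Localization.

(* Main.v *)
(* Call an object local if it is orthogonal to every morphism of a class S all
   of whose members go between countable groups.  The value of the reflection
   at A is built from formal terms: elements of A, products, inverses, and, for
   f : C -> D in S and a point of D, the value at that point of the extension
   along f of a map C -> X prescribed on C by earlier terms.  Countability lets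
   f be recorded by a multiplication table on nat, so that the terms form a
   small type.  A map g : A -> X to a local object evaluates terms partially in
   X; the reflection consists of the terms that have a value under every such
   g, two terms being identified when all their values agree.  It is local
   because the terms are closed under extension, and maps out of it are unique
   because evaluating along the unit A -> E A is the identity. *)

Require Import Defs.
From mathcomp Require Import all_boot.
From HB Require Import structures.
From mathcomp Require Import boolp classical_sets cardinality.

Set Implicit Arguments.
Unset Strict Implicit.
Unset Printing Implicit Defensive.

Local Open Scope classical_set_scope.
Local Open Scope group_scope.

(** * Countability of finitely generated and finitely presented groups *)

Lemma multiplicative1 (A B : groupType) (f : {multiplicative A -> B}) :
  f 1 = 1.
Proof. by apply: (mulIg (f 1)); rewrite -gmulfM !mul1g. Qed.

Lemma sub_generated (A : groupType) (S : set A) : S `<=` generated S.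
Proof. exact: sub_gen_smallest. Qed.

Lemma subgroup_generated (A : groupType) (S : set A) : subgroup (generated S).
Proof.
split=> [T [[] //]|x y Sx Sy T ST|x Sx T ST]; have [[T1 TM TV] _] := ST.
  by apply: TM; [apply: Sx|apply: Sy].
by apply: TV; apply: Sx.
Qed.

Definition enumerable (T : Type) : Prop :=
  exists e : nat -> T, forall x, exists i, e i = x.

Lemma enumerable_image (T U : Type) (f : T -> U) :
  (forall y, exists x, f x = y) -> enumerable T -> enumerable U.
Proof.
move=> f_surj [e e_surj]; exists (f \o e) => y.
by have [x <-] := f_surj y; have [i <-] := e_surj x; exists i.
Qed.

Lemma countType_enumerable (T : countType) (x0 : T) : enumerable T.
Proof.
exists (fun i => odflt x0 (unpickle i)) => x.
by exists (pickle x); rewrite pickleK.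
Qed.

Lemma finitely_generated_enumerable (A : groupType) :
  finitely_generated A -> enumerable A.
Proof.
move=> [S /finite_seqP[s ->] genT].
(* The boolean selects the inverse; an index out of range gives 1, so every list in the countable
   type is a word. *)
pose letter (p : nat * bool) := if p.2 then (nth 1 s p.1)^-1 else nth 1 s p.1.
pose word (w : seq (nat * bool)) := \big[*%g/1]_(p <- w) letter p.
apply: (@enumerable_image _ _ word) (countType_enumerable [::]) => a.
suff [w _ <-] : range word a by exists w.
have : generated [set` s] a by rewrite genT.
apply: (smallest_sub (C := @subgroup A)).
- split.
  + by exists [::]; rewrite // /word big_nil.
  + move=> _ _ [v _ <-] [w _ <-]; exists (v ++ w); rewrite // /word big_cat //.
  + move=> _ [w _ <-]; elim: w => [|p w [w' _ w'E]].
      by exists [::]; rewrite // /word big_nil invg1.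
    exists (w' ++ [:: (p.1, ~~ p.2)]) => //.
    rewrite /word big_cat big_seq1 big_cons invgM; congr (_ * _) => //.
    by rewrite /letter /=; case: p.2; rewrite ?invgK.
- move=> x /= xs; exists [:: (index x s, false)] => //.
  by rewrite /word big_seq1 /letter /= nth_index.
Qed.

Section GeneratedSubgroup.
Variables (A : groupType) (S : set A).

Definition generated_pred : {pred A} := fun x => `[< generated S x >].

Lemma generated_pred_closed : group_closed generated_pred.
Proof.
have [S1 SM SV] := subgroup_generated S; split=> [|x y]; rewrite !unfold_in.
  exact/asboolP.
by move=> /asboolP Sx /asboolP Sy; apply/asboolP; apply: (SM) => //; apply: (SV).
Qed.

(** A group type of its own, so that it can be a target in the universal property of a free
    group. *)
Record generated_type :=
  GeneratedElt { generated_val : A; _ : generated_val \in generated_pred }.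
HB.instance Definition _ := [isSub for generated_val].
HB.instance Definition _ := [Choice of generated_type by <:].
HB.instance Definition _ := SubChoice_isSubGroup.Build A generated_pred
  generated_type generated_pred_closed.

End GeneratedSubgroup.

(** By uniqueness in the universal property, the identity of [F] factors through the inclusion of
    the subgroup generated by [x]. *)
Lemma free_generated (F : groupType) n (x : 'I_n -> F) :
  free_on x -> generated (range x) = [set: F].
Proof.
move=> free_x; pose H : groupType := generated_type (range x).
have inH i : x i \in generated_pred (range x).
  by apply/asboolP; apply: sub_generated; apply: imageT.
have [phi [phiE _]] := free_x H (fun i => GeneratedElt (inH i)).
have [psi [_ psi_uniq]] := free_x F x.
have idE : psi = (val : {multiplicative H -> F}) \o phi.
  by apply: psi_uniq => i /=; rewrite phiE.
rewrite -subTset => y _.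
have -> : y = val (phi y).
  have -> : val (phi y) = psi y by rewrite idE.
  by rewrite (psi_uniq (idfun : {multiplicative F -> F})).
by have /asboolP := valP (phi y).
Qed.

Lemma finitely_presented_enumerable (B : groupType) :
  finitely_presented B -> enumerable B.
Proof.
move=> [n [F [x [pi [free_x pi_surj _]]]]].
apply: enumerable_image pi_surj _; apply: finitely_generated_enumerable.
by exists (range x); [exact: finite_image|exact: free_generated].
Qed.

(** * Formal terms and coded morphisms *)

Section ExtensionTerms.
Variables (G : groupType) (A : Type).

(* [Ext M gam F t j] stands for a morphism f : C -> D given through
   enumerations c of C and d of D: [M i j k] means d_i d_j = d_k, [gam i] is
   the image of d_i in G, and f c_i = d_(F i).  The term names the value at d_j
   of the extension along f of the map c_i |-> t_i. *)
Inductive term : Type :=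
  | Base of A
  | Mul of term & term
  | Inv of term
  | Ext (M : nat -> nat -> nat -> Prop) (gam : nat -> G) (F : nat -> nat)
        (t : nat -> term) (j : nat).

End ExtensionTerms.

Arguments Base {G A}.
Arguments Mul {G A}.
Arguments Inv {G A}.
Arguments Ext {G A}.

Definition mul_table (B : groupType) (d : nat -> B) (i j k : nat) : Prop :=
  d i * d j = d k.

Section EncodedMorphisms.
Variable G : groupType.
Implicit Types C D X : grp_over G.

Definition encodes C D (f : hom_over C D) (c : nat -> C) (d : nat -> D)
    (M : nat -> nat -> nat -> Prop) (gam : nat -> G) (F : nat -> nat) : Prop :=
  [/\ forall x, exists i, c i = x, forall y, exists i, d i = y,
      mul_table d = M, proj_of D \o d = gam & forall i, d (F i) = f (c i)].

Lemma encodes_exists C D (f : hom_over C D) :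
  enumerable C -> enumerable D ->
  exists c d M gam F, @encodes C D f c d M gam F.
Proof.
move=> [c c_surj] [d d_surj].
have [F FE] := choice (fun i => d_surj (f (c i))).
by exists c, d, (mul_table d), (proj_of D \o d), F.
Qed.

(* The table determines equality: d_i = d_j iff d_i d_k = d_j for some k with
   d_k d_k = d_k. *)
Lemma mul_table_hom D D' (d : nat -> D) (d' : nat -> D') :
  (forall y, exists i, d i = y) ->
  mul_table d = mul_table d' -> proj_of D \o d = proj_of D' \o d' ->
  exists theta : hom_over D D', forall i, theta (d i) = d' i.
Proof.
move=> d_surj tabE projE; have [th thE] := choice d_surj.
have mulE i j k : d i * d j = d k -> d' i * d' j = d' k.
  by move=> ijk; have : mul_table d i j k by []; rewrite tabE.
have d'E i j : d i = d j -> d' i = d' j.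
  move=> ij; have [z z1] := d_surj 1.
  have z1' : d' z = 1.
    by apply: (mulIg (d' z)); rewrite mul1g; apply: mulE; rewrite z1 mul1g.
  by have := mulE i z j; rewrite z1 z1' !mulg1 => ->.
have thM : {morph d' \o th : x y / x * y}.
  by move=> x y /=; apply/esym/mulE; rewrite !thE.
pose phi := HB.pack_for {multiplicative D -> D'} (d' \o th)
  (isMultiplicative.Build D D' (d' \o th) thM).
have phiP y : proj_of D' (phi y) = proj_of D y.
  by have /= <- := congr1 (@^~ (th y)) projE; rewrite thE.
by exists (HomOver phiP) => i; apply: d'E; rewrite thE.
Qed.

End EncodedMorphisms.

(** * Objects orthogonal to a class of morphisms *)

Section Reflection.
Variables (G : groupType) (S : forall X Y : grp_over G, hom_over X Y -> Prop).
Arguments S {X Y}.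
Hypothesis S_enumerable : forall (X Y : grp_over G) (f : hom_over X Y),
  S f -> enumerable X /\ enumerable Y.

Definition orthogonal (X : grp_over G) : Prop :=
  forall (C D : grp_over G) (f : hom_over C D), S f ->
    forall k : hom_over C X, exists! h : hom_over D X, comp_over h f = k.

Lemma comp_over_eq (X Y Z : grp_over G) (h : hom_over Y Z) (f : hom_over X Y)
    (k : hom_over X Z) : comp_over h f = k -> forall a, h (f a) = k a.
Proof. by move=> <-. Qed.

Lemma orthogonal_inj (X C D : grp_over G) (f : hom_over C D)
    (h h' : hom_over D X) :
  orthogonal X -> S f -> comp_over h f = comp_over h' f -> h = h'.
Proof.
move=> oX Sf hh'; have [k [_ k_uniq]] := oX _ _ f Sf (comp_over h' f).
by rewrite -(k_uniq h) // -(k_uniq h').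
Qed.

(** Evaluation into this object will supply the projection of the reflection to [G]. *)
Definition terminal_over : grp_over G :=
  GrpOver (proj_of := (idfun : {multiplicative G -> G}))
    (fun g => ex_intro _ g erefl).

Definition to_terminal (X : grp_over G) : hom_over X terminal_over :=
  @HomOver G X terminal_over (proj_of X) (fun=> erefl).

Lemma to_terminal_uniq (X : grp_over G) (h : hom_over X terminal_over) :
  h = to_terminal X.
Proof. by apply: hom_over_ext => a; rewrite /= -(hom_funP h). Qed.

Lemma terminal_orthogonal : orthogonal terminal_over.
Proof.
move=> C D f _ k; exists (to_terminal D); split=> [|h _].
  by rewrite [k]to_terminal_uniq; apply: to_terminal_uniq.
exact/esym/to_terminal_uniq.
Qed.

(** * Partial evaluation of terms *)

Section ReflectionAt.
Variable A : grp_over G.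
Local Notation term := (term G A).

(** A relation, since an [Ext] term has a value only when the [t i] evaluate to the restriction
    along [f] of some [h]. Groups are quantified over only inside [Prop], so classes of terms stay
    small. *)
Fixpoint eval (X : grp_over G) (g : hom_over A X) (t : term) (x : X) : Prop :=
  match t with
  | Base a => x = g a
  | Mul t1 t2 =>
      exists x1 x2, [/\ eval g t1 x1, eval g t2 x2 & x = x1 * x2]
  | Inv t1 => exists2 x1, eval g t1 x1 & x = x1^-1
  | Ext M gam F t j =>
      exists (C D : grp_over G) (f : hom_over C D) c d (h : hom_over D X),
        [/\ S f, encodes f c d M gam F,
            forall i, eval g (t i) (h (d (F i))) & x = h (d j)]
  end.

(** For two readings of one code, [theta] matches the enumerations of [D] and [D']; by induction [h]
    and [h' \o theta] agree on the image of [f], hence everywhere by orthogonality. *)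
Lemma eval_fun (X : grp_over G) (g : hom_over A X) t x y :
  orthogonal X -> eval g t x -> eval g t y -> x = y.
Proof.
move=> oX; elim: t x y => [a|t IHt u IHu|t IHt|M gam F t IHt j] x y /=.
- by move=> -> ->.
- by move=> [x1 [x2 [/IHt t1 /IHu t2 ->]]] [y1 [y2 [/t1 -> /t2 ->]]].
- by move=> [x1 /IHt t1 ->] [y1 /t1 -> ->].
move=> [C [D [f [c [d [h [Sf [c_surj d_surj dM dgam dF] th ->]]]]]]].
move=> [C' [D' [f' [c' [d' [h' [_ [_ _ dM' dgam' _] th' ->]]]]]]].
have [|theta thE] := mul_table_hom d_surj (etrans dM (esym dM')).
  by rewrite dgam dgam'.
suff -> : h = comp_over h' theta by rewrite /= thE.
apply: orthogonal_inj oX Sf _; apply: hom_over_ext => a /=.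
have [i <-] := c_surj a; rewrite -dF thE.
exact: IHt (th i) (th' i).
Qed.

Lemma eval_natural (X Y : grp_over G) (g : hom_over A X) (phi : hom_over X Y)
    t x : eval g t x -> eval (comp_over phi g) t (phi x).
Proof.
elim: t x => [a|t IHt u IHu|t IHt|M gam F t IHt j] x /=.
- by move=> ->.
- move=> [x1 [x2 [/IHt ? /IHu ? ->]]]; exists (phi x1), (phi x2).
  by split=> //; apply: gmulfM.
- move=> [x1 /IHt ? ->]; exists (phi x1) => //.
  by apply: (mulIg (phi x1)); rewrite -gmulfM !mulVg multiplicative1.
move=> [C [D [f [c [d [h [Sf fE th ->]]]]]]].
by exists C, D, f, c, d, (comp_over phi h); split=> // i; apply: IHt.
Qed.

(** The default 1 marks the absence of a value; total terms never meet it in an orthogonal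
    object. *)
Definition value (X : grp_over G) (g : hom_over A X) (t : term) : X :=
  xget 1 (eval g t).

Definition total (t : term) : Prop :=
  forall X, orthogonal X -> forall g : hom_over A X, exists x, eval g t x.

Definition equivalent (t u : term) : Prop :=
  forall X, orthogonal X -> forall g : hom_over A X, value g t = value g u.

Lemma value_eq X (g : hom_over A X) t x :
  orthogonal X -> eval g t x -> value g t = x.
Proof. by move=> oX tx; apply: xget_unique => // y ty; apply: eval_fun ty tx. Qed.

(** * The group of classes of total terms *)

Record elt := Elt {
  elt_class : term -> Prop;
  elt_classP : exists2 t, total t & elt_class = equivalent t }.
HB.instance Definition _ := gen_eqMixin elt.
HB.instance Definition _ := gen_choiceMixin elt.

(** A total member is chosen, since the default in [value] may put other terms in the class. *)
Definition rep (q : elt) : term := s2val (cid2 (elt_classP q)).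

Definition elt_at (X : grp_over G) (g : hom_over A X) (q : elt) : X :=
  value g (rep q).

Lemma rep_total q : total (rep q).
Proof. by rewrite /rep; case: cid2. Qed.

Lemma rep_class q : elt_class q = equivalent (rep q).
Proof. by rewrite /rep; case: cid2. Qed.

Lemma eval_rep X (g : hom_over A X) q :
  orthogonal X -> eval g (rep q) (elt_at g q).
Proof.
move=> oX; have [x qx] := rep_total q oX g.
by rewrite /elt_at (value_eq oX qx).
Qed.

Lemma elt_ext q r :
  (forall X, orthogonal X -> forall g : hom_over A X,
     elt_at g q = elt_at g r) -> q = r.
Proof.
move=> qr; have : elt_class q = elt_class r.
  rewrite !rep_class; apply/funext => v; apply/propext.
  split=> qv X oX g; rewrite -(qv X oX g); last exact: qr.
  exact/esym/qr.
case: q r {qr} => [Q QP] [R RP] /= QR; subst R.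
by rewrite (Prop_irrelevance QP RP).
Qed.

(** The counterpart of [elt_ext] for existence: elements are built from terms here and afterwards
    handled only through their values. *)
Lemma elt_of_term (t : term) (P : forall X, hom_over A X -> X -> Prop) :
  (forall X, orthogonal X -> forall g : hom_over A X,
     exists2 x, eval g t x & P X g x) ->
  exists q, forall X, orthogonal X -> forall g : hom_over A X,
    P X g (elt_at g q).
Proof.
move=> tP; have tot : total t.
  by move=> X oX g; have [x tx _] := tP X oX g; exists x.
pose q := Elt (ex_intro2 _ _ t tot erefl); exists q => X oX g.
have qt : equivalent (rep q) t by rewrite -rep_class.
rewrite /elt_at qt //.
by have [x tx Px] := tP X oX g; rewrite (value_eq oX tx).
Qed.

Lemma elt_base a :
  exists q, forall X, orthogonal X -> forall g : hom_over A X,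
    elt_at g q = g a.
Proof.
apply: (@elt_of_term (Base a) (fun X g x => x = g a)) => X oX g.
by exists (g a).
Qed.

Lemma elt_mul_exists q r :
  exists s, forall X, orthogonal X -> forall g : hom_over A X,
    elt_at g s = elt_at g q * elt_at g r.
Proof.
apply: (@elt_of_term (Mul (rep q) (rep r))
  (fun X g x => x = elt_at g q * elt_at g r)) => X oX g.
exists (elt_at g q * elt_at g r) => //=.
by exists (elt_at g q), (elt_at g r); split=> //; apply: eval_rep.
Qed.

Lemma elt_inv_exists q :
  exists s, forall X, orthogonal X -> forall g : hom_over A X,
    elt_at g s = (elt_at g q)^-1.
Proof.
apply: (@elt_of_term (Inv (rep q)) (fun X g x => x = (elt_at g q)^-1)) => X oX g.
by exists (elt_at g q)^-1 => //=; exists (elt_at g q) => //; apply: eval_rep.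
Qed.

Definition elt_one : elt := projT1 (cid (elt_base 1)).
Definition elt_mul q r : elt := projT1 (cid (elt_mul_exists q r)).
Definition elt_inv q : elt := projT1 (cid (elt_inv_exists q)).

Section At.
Variables (X : grp_over G) (oX : orthogonal X) (g : hom_over A X).

Lemma elt_at1 : elt_at g elt_one = 1.
Proof. by rewrite (projT2 (cid (elt_base 1))) // multiplicative1. Qed.

Lemma elt_atM q r : elt_at g (elt_mul q r) = elt_at g q * elt_at g r.
Proof. exact: (projT2 (cid (elt_mul_exists q r))). Qed.

Lemma elt_atV q : elt_at g (elt_inv q) = (elt_at g q)^-1.
Proof. exact: (projT2 (cid (elt_inv_exists q))). Qed.

Lemma elt_at_natural Y (oY : orthogonal Y) (phi : hom_over X Y) q :
  elt_at (comp_over phi g) q = phi (elt_at g q).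
Proof. by apply: value_eq => //; apply/eval_natural/eval_rep. Qed.

End At.

Lemma elt_mulA : associative elt_mul.
Proof. by move=> q r s; apply: elt_ext => X oX g; rewrite !elt_atM // mulgA. Qed.

Lemma elt_mul1 : left_id elt_one elt_mul.
Proof.
by move=> q; apply: elt_ext => X oX g; rewrite elt_atM // elt_at1 // mul1g.
Qed.

Lemma elt_mulr1 : right_id elt_one elt_mul.
Proof.
by move=> q; apply: elt_ext => X oX g; rewrite elt_atM // elt_at1 // mulg1.
Qed.

Lemma elt_mulV : left_inverse elt_one elt_inv elt_mul.
Proof.
move=> q; apply: elt_ext => X oX g.
by rewrite elt_atM // elt_atV // elt_at1 // mulVg.
Qed.

Lemma elt_mulrV : right_inverse elt_one elt_inv elt_mul.
Proof.
move=> q; apply: elt_ext => X oX g.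
by rewrite elt_atM // elt_atV // elt_at1 // mulgV.
Qed.

HB.instance Definition _ :=
  isGroup.Build elt elt_mulA elt_mul1 elt_mulr1 elt_mulV elt_mulrV.

(** * Projection to [G], evaluation maps and the unit *)

Definition elt_at_mul X (oX : orthogonal X) (g : hom_over A X) :
    {multiplicative elt -> X} :=
  HB.pack_for {multiplicative elt -> X} (elt_at g)
    (isMultiplicative.Build elt X (elt_at g) (elt_atM oX g)).

Lemma elt_proj_surj (b : G) :
  exists q, elt_at_mul terminal_orthogonal (to_terminal A) q = b.
Proof.
have [a <-] := proj_of_surj A b; have [q qE] := elt_base a.
by exists q; rewrite /= qE //; apply: terminal_orthogonal.
Qed.

Definition reflection : grp_over G := GrpOver elt_proj_surj.

(** Naturality of evaluation along [to_terminal X]. *)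
Lemma elt_atP X (oX : orthogonal X) (g : hom_over A X) (q : reflection) :
  proj_of X (elt_at_mul oX g q) = proj_of reflection q.
Proof.
rewrite /= -(to_terminal_uniq (comp_over (to_terminal X) g)).
by rewrite (elt_at_natural oX) //; apply: terminal_orthogonal.
Qed.

Definition extend X (oX : orthogonal X) (g : hom_over A X) :
    hom_over reflection X := HomOver (elt_atP oX g).

Definition unit_fun (a : A) : reflection := projT1 (cid (elt_base a)).

Lemma elt_at_unit X (oX : orthogonal X) (g : hom_over A X) a :
  elt_at g (unit_fun a) = g a.
Proof. exact: (projT2 (cid (elt_base a))). Qed.

Lemma unit_funM : {morph unit_fun : x y / x * y}.
Proof.
move=> x y; apply: elt_ext => X oX g.
by rewrite elt_atM // !elt_at_unit // gmulfM.
Qed.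

HB.instance Definition _ :=
  isMultiplicative.Build A reflection unit_fun unit_funM.

Lemma unit_funP a : proj_of reflection (unit_fun a) = proj_of A a.
Proof. by rewrite /= elt_at_unit //; apply: terminal_orthogonal. Qed.

Definition reflection_unit : hom_over A reflection :=
  @HomOver G A reflection unit_fun unit_funP.

Lemma extend_unit X (oX : orthogonal X) (g : hom_over A X) :
  comp_over (extend oX g) reflection_unit = g.
Proof. by apply: hom_over_ext => a /=; apply: elt_at_unit. Qed.

(** * Orthogonality and universal property of the reflection *)

(** Countability of [C] and [D] gives an [Ext] term on representatives of the [k (c i)]; under each
    [g] its value is that of the extension along [f] of the evaluated [k]. *)
Lemma elt_extension (C D : grp_over G) (f : hom_over C D)
    (k : hom_over C reflection) (b : D) : S f ->
  exists q : reflection, forall X, orthogonal X -> forall g : hom_over A X,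
    forall h : hom_over D X, (forall a, h (f a) = elt_at g (k a)) ->
    elt_at g q = h b.
Proof.
move=> Sf; have [eC eD] := S_enumerable Sf.
have [c [d [M [gam [F fE]]]]] := encodes_exists f eC eD.
have [c_surj d_surj _ _ dF] := fE; have [j <-] := d_surj b.
apply: (@elt_of_term (Ext M gam F (fun i => rep (k (c i))) j)
  (fun X g x => forall h : hom_over D X,
     (forall a, h (f a) = elt_at g (k a)) -> x = h (d j))) => X oX g.
have [h [hE h_uniq]] := oX _ _ f Sf (comp_over (extend oX g) k).
have {}hE a : h (f a) = elt_at g (k a) := comp_over_eq hE a.
exists (h (d j)).
  exists C, D, f, c, d, h; split=> // i.
  by rewrite dF hE; apply: eval_rep.
move=> h' h'E; rewrite (h_uniq h') //.
by apply: hom_over_ext => a /=; rewrite h'E.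
Qed.

(** After each evaluation [H] becomes a true extension in an orthogonal object, where its required
    properties can be checked. *)
Lemma reflection_orthogonal : orthogonal reflection.
Proof.
move=> C D f Sf k; have [H HE] := choice (fun b => elt_extension k b Sf).
have HP X (oX : orthogonal X) (g : hom_over A X) : exists h : hom_over D X,
    (forall b, elt_at g (H b) = h b) /\ forall a, h (f a) = elt_at g (k a).
  have [h [hE _]] := oX _ _ f Sf (comp_over (extend oX g) k).
  have {}hE a : h (f a) = elt_at g (k a) := comp_over_eq hE a.
  by exists h; split=> // b; apply: HE.
have HM : {morph H : x y / x * y}.
  move=> x y; apply: elt_ext => X oX g; have [h [hE _]] := HP X oX g.
  by rewrite elt_atM // !hE gmulfM.
pose H' := HB.pack_for {multiplicative D -> reflection} H
  (isMultiplicative.Build D reflection H HM).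
have projH b : proj_of reflection (H' b) = proj_of D b.
  have [h [hE _]] := HP _ terminal_orthogonal (to_terminal A).
  by rewrite /= hE [h]to_terminal_uniq.
exists (HomOver projH); split=> [|h' h'E].
  apply: hom_over_ext => a /=; apply: elt_ext => X oX g.
  by have [h [-> ->]] := HP X oX g.
(* Followed by evaluation along [g], [h'] extends the evaluated [k], which fixes its values. *)
apply: hom_over_ext => b /=; apply: elt_ext => X oX g.
apply: (HE b X oX g (comp_over (extend oX g) h')) => a.
by rewrite -h'E.
Qed.

(** The reflection is now itself a target for evaluation. As [g] is [extend oX g] after the unit,
    naturality gives both sides the same values. *)
Lemma elt_at_reflection_unit q : elt_at reflection_unit q = q.
Proof.
apply: elt_ext => X oX g.
rewrite -[RHS](congr1 (fun g' => elt_at g' q) (extend_unit oX g)).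
by rewrite (elt_at_natural reflection_orthogonal).
Qed.

(** By naturality, [elt_at g q = h (elt_at reflection_unit q) = h q]. *)
Lemma extend_uniq X (oX : orthogonal X) (g : hom_over A X)
    (h : hom_over reflection X) :
  comp_over h reflection_unit = g -> h = extend oX g.
Proof.
move=> <-; apply: hom_over_ext => q /=.
by rewrite (elt_at_natural reflection_orthogonal) // elt_at_reflection_unit.
Qed.

End ReflectionAt.

(** * The reflection as a functor inverting [S] *)

Lemma reflection_hom_ext A X (h h' : hom_over (reflection A) X) :
  orthogonal X ->
  comp_over h (reflection_unit A) = comp_over h' (reflection_unit A) -> h = h'.
Proof.
by move=> oX hh'; rewrite (extend_uniq oX hh') -(extend_uniq oX erefl).
Qed.

Definition reflection_map A B (f : hom_over A B) :
    hom_over (reflection A) (reflection B) :=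
  extend (@reflection_orthogonal B) (comp_over (reflection_unit B) f).

Lemma comp_overA (W X Y Z : grp_over G) (h : hom_over Y Z) (g : hom_over X Y)
    (f : hom_over W X) :
  comp_over h (comp_over g f) = comp_over (comp_over h g) f.
Proof. exact: hom_over_ext. Qed.

Lemma comp_id_over (X Y : grp_over G) (f : hom_over X Y) :
  comp_over (id_over Y) f = f.
Proof. exact: hom_over_ext. Qed.

Lemma comp_over_id (X Y : grp_over G) (f : hom_over X Y) :
  comp_over f (id_over X) = f.
Proof. exact: hom_over_ext. Qed.

Lemma reflection_map_unit A B (f : hom_over A B) :
  comp_over (reflection_unit B) f =
  comp_over (reflection_map f) (reflection_unit A).
Proof. by rewrite extend_unit. Qed.

Lemma reflection_map_id A : reflection_map (id_over A) = id_over (reflection A).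
Proof.
apply: reflection_hom_ext; first exact: reflection_orthogonal.
by rewrite -reflection_map_unit comp_id_over comp_over_id.
Qed.

Lemma reflection_map_comp A B C (g : hom_over B C) (f : hom_over A B) :
  reflection_map (comp_over g f) =
  comp_over (reflection_map g) (reflection_map f).
Proof.
apply: reflection_hom_ext; first exact: reflection_orthogonal.
rewrite -reflection_map_unit -comp_overA -reflection_map_unit !comp_overA.
by rewrite -reflection_map_unit.
Qed.

Definition reflection_functor : functor_over G :=
  FunctorOver reflection_map_id reflection_map_comp.

Definition reflection_nat : nat_from_id reflection_functor :=
  @NatFromId G reflection_functor reflection_unit reflection_map_unit.

(** The unit of [A] extends along [f] to [h], and the inverse is the extension of [h] to
    [reflection B]. *)
Lemma reflection_map_iso A B (f : hom_over A B) :
  S f -> iso_over (reflection_map f).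
Proof.
move=> Sf; have oA := @reflection_orthogonal A.
have oB := @reflection_orthogonal B.
have [h [hE _]] := oA _ _ f Sf (reflection_unit A).
exists (extend oA h); split; apply: reflection_hom_ext => //.
  rewrite -comp_overA -reflection_map_unit comp_overA extend_unit hE.
  by rewrite comp_id_over.
(* Restricted to [B], the two maps need only be compared along [f], because [reflection B] is
   orthogonal. *)
rewrite -comp_overA extend_unit; apply: orthogonal_inj oB Sf _.
by rewrite -!comp_overA hE -reflection_map_unit comp_id_over.
Qed.

End Reflection.

Theorem theorem1p0p1 (G : groupType) :
  exists (E : functor_over G) (p : nat_from_id E),
    is_localization p /\
    forall (A B : grp_over G) (f : hom_over A B),
      Omega f -> iso_over (fmap E f).
Proof.
have Om_enum (A B : grp_over G) (f : hom_over A B) :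
    Omega f -> enumerable A /\ enumerable B.
  move=> [[fgA fpB] _ _ _]; split; first exact: finitely_generated_enumerable.
  exact: finitely_presented_enumerable.
exists (reflection_functor Om_enum), (reflection_nat Om_enum); split.
  (* [local_over X] unfolds to orthogonality for [Omega], so [locX] can be passed to [extend]. *)
  move=> A X g locX; exists (extend locX g); split; first exact: extend_unit.
  by move=> h hE; apply/esym/extend_uniq.
by move=> A B f Of; apply: (reflection_map_iso Om_enum).
Qed.
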